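(* Let $n\ge 1$ and let $P,Q\in\mathbb R[X_1,\ldots,X_n]$ be such that $\mathcal Z_P=\mathcal Z_Q$. Then $P$ is of type A if and only if $Q$ is of type A.
   Context: For $P\in\mathbb R[X_1,\ldots,X_n]$, let $\mathcal Z_P=\{x\in\mathbb R^n: P(x)=0\}$ and let $(P)$ be the ideal of $\mathbb R[X_1,\ldots,X_n]$ generated by $P$. A linear functional $\Lambda:\mathbb R[X_1,\ldots,X_n]\to\mathbb R$ is positive definite if $\Lambda(R^2)\ge 0$ for every $R\in\mathbb R[X_1,\ldots,X_n]$. It is a moment functional if there is a positive Borel measure $\mu$ on $\mathbb R^n$, with respect to which all polynomials are absolutely integrable, such that $\Lambda(R)=\int_{\mathbb R^n}R\,d\mu$ for all $R\in\mathbb R[X_1,\ldots,X_n]$. The polynomial $P$ is of type A if every positive definite linear functional $\Lambda:\mathbb R[X_1,\ldots,X_n]\to\mathbb R$ vanishing on $(P)$ is a moment functional. *)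

(* Defs.v *)
From HB Require Import structures.
From mathcomp Require Import all_boot all_order all_algebra.
From mathcomp Require Import all_classical all_reals all_analysis.
(* Only the structure instances: the notations of mpoly clash with those of
   MathComp-Analysis. *)
From mathcomp Require Import (canonicals) mpoly.

Set Implicit Arguments.
Unset Strict Implicit.
Unset Printing Implicit Defensive.

Import Order.TTheory GRing.Theory Num.Theory.
Import numFieldNormedType.Exports.

Local Open Scope classical_set_scope.
Local Open Scope ring_scope.

Definition mpoly_eval (R : realType) (n : nat) (P : mpoly.mpoly n R)
    (x : 'rV[R]_n) : R := mpoly.meval (x ord0) P.

Definition zero_set (R : realType) (n : nat) (P : mpoly.mpoly n R) :
    set 'rV[R]_n := [set x | mpoly_eval P x = 0].

Definition principal_ideal (R : realType) (n : nat) (P : mpoly.mpoly n R) :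
    set (mpoly.mpoly n R) := [set F | exists S, F = S * P].

(* R^n, as row vectors, with the sigma-algebra generated by its open sets. *)
Definition borel_rV (R : realType) (n : nat) :=
  g_sigma_algebraType (@open 'rV[R]_n).

Definition positive_definite (R : realType) (n : nat)
    (L : {scalar mpoly.mpoly n R}) : Prop :=
  forall F : mpoly.mpoly n R, 0 <= L (F ^+ 2).

(* Integrability includes measurability and finiteness of the integral of the
   absolute value; F = 1 makes mu finite. *)
Definition moment_functional (R : realType) (n : nat)
    (L : {scalar mpoly.mpoly n R}) : Prop :=
  exists mu : {measure set (borel_rV R n) -> \bar R},
    (forall F : mpoly.mpoly n R,
       mu.-integrable setT (fun x => (mpoly_eval F x)%:E)) /\
    (forall F : mpoly.mpoly n R,
       (L F)%:E = (\int[mu]_x (mpoly_eval F x)%:E)%E).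

Definition type_A (R : realType) (n : nat) (P : mpoly.mpoly n R) : Prop :=
  forall L : {scalar mpoly.mpoly n R},
    positive_definite L ->
    (forall F, principal_ideal P F -> L F = 0) ->
    moment_functional L.

(* Main.v *)
(** If [L] is positive definite and vanishes on [(Q)], it vanishes on [(P)] as soon as
    [P] vanishes on the zero set of [Q]: the real Nullstellensatz gives an identity
    [P ^ (2k) + sum of squares = H * Q], so [L (P ^ (2k)) = 0], and Cauchy-Schwarz for
    [(F, G) |-> L (F * G)] brings the exponent down to [1].

    For the Nullstellensatz, if there is no such identity then Zorn's lemma extends
    sums of squares + [(Q)] to a prime cone whose support contains [Q] but not [P].
    Restricted to a countable ring of definition, this cone orders a field, which lies
    in a countable algebraically closed field; a maximal ordered subfield of the latter
    is real closed, and there [Q = 0, P <> 0] has a solution.  Tarski's transfer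
    principle, obtained from Sturm sequences, moves it to the reals. *)

Require Import Defs.
From HB Require Import structures.
From mathcomp Require Import all_boot all_order all_algebra.
From mathcomp Require Import all_classical all_reals all_analysis.
From mathcomp Require Import (canonicals) mpoly.
From mathcomp Require Import closed_field polyorder polyrcf qe_rcf_th.
From mathcomp Require Import zify ring.

Set Implicit Arguments.
Unset Strict Implicit.
Unset Printing Implicit Defensive.

Import Order.TTheory GRing.Theory Num.Theory.

Local Open Scope classical_set_scope.
Local Open Scope ring_scope.

(** * Transfer of sign conditions between real closed fields *)

(** The pseudo-remainder carries a power of [lead_coef q], and [next_mod] multiplies by that power
    once more; the total factor is a square, hence positive. *)
Lemma next_modE (F : rcfType) (p q : {poly F}) : q != 0 ->
  exists2 c : F, 0 < c & next_mod p q = - (c *: (p %% q)).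
Proof.
move=> q0; exists ((lead_coef q ^+ 2) ^+ Pdiv.Ring.rscalp p q).
  by rewrite exprn_gt0 // exprn_even_gt0 //= lead_coef_eq0.
have lqU : lead_coef q ^+ Pdiv.Ring.rscalp p q != 0.
  by rewrite expf_neq0 // lead_coef_eq0.
rewrite /next_mod modpE scalerA.
by rewrite -exprM mulnC exprM expr2 mulfK // scaleNr.
Qed.

Lemma cindexR_mulC (F : rcfType) (c : F) (p q : {poly F}) :
  cindexR (c *: p) q = sgz c * cindexR p q.
Proof.
by rewrite /cindexR mulr_sumr; apply: eq_bigr => x _; rewrite jump_mulCp.
Qed.

(* One step of the Euclidean algorithm for the Cauchy index; the factor [a ^+ 2]
   avoids division and is positive. *)
Lemma cindexR_step (F : rcfType) (a : F) (p q h : {poly F}) :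
  a != 0 -> q != 0 ->
  cindexR q p =
    crossR (p * q) + (cindexR q (a ^+ 2 *: p - h * q)
                      - crossR ((a ^+ 2 *: p - h * q) * q)).
Proof.
move=> a0 q0; rewrite cindexR_rec [cindexR q (_ - _)]cindexR_rec addrAC subrr add0r.
congr (_ + _).
have [c cgt0 ->] := next_modE p q0.
have [d dgt0 ->] := next_modE (a ^+ 2 *: p - h * q) q0.
rewrite modpD modpZl modpN modp_mull oppr0 addr0 scalerA -!scaleNr !cindexR_mulC.
by rewrite !sgzN !gtr0_sgz // mulr_gt0 // exprn_even_gt0.
Qed.

Lemma cindexR_swap (F : rcfType) (p q : {poly F}) :
  q != 0 -> (size p < size q)%N ->
  cindexR q p = crossR (p * q) - cindexR p q.
Proof.
move=> q0 pq; rewrite cindexR_rec; have [c cgt0 ->] := next_modE p q0.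
by rewrite modp_small // -scaleNr cindexR_mulC sgzN gtr0_sgz // mulN1r.
Qed.

Section Transfer.

(** Elimination is done semantically: a finite list [T] in [D] whose signs settle a question takes
    the place of a quantifier-free formula. *)
Definition agree (D : comNzRingType) (T : seq D) (F1 F2 : rcfType)
    (f1 : {rmorphism D -> F1}) (f2 : {rmorphism D -> F2}) : Prop :=
  forall t, t \in T -> sgz (f1 t) = sgz (f2 t).

Lemma agree_cat (D : comNzRingType) (T1 T2 : seq D) (F1 F2 : rcfType)
    (f1 : {rmorphism D -> F1}) (f2 : {rmorphism D -> F2}) :
  agree (T1 ++ T2) f1 f2 -> agree T1 f1 f2 /\ agree T2 f1 f2.
Proof. by move=> h; split=> t ht; apply: h; rewrite mem_cat ht ?orbT. Qed.

Lemma agree_sym (D : comNzRingType) (T : seq D) (F1 F2 : rcfType)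
    (f1 : {rmorphism D -> F1}) (f2 : {rmorphism D -> F2}) :
  agree T f1 f2 -> agree T f2 f1.
Proof. by move=> h t /h. Qed.

Variable D : comNzRingType.

Lemma agree_eq0 (F1 F2 : rcfType) (x : F1) (y : F2) :
  sgz x = sgz y -> (x == 0) = (y == 0).
Proof. by move=> h; rewrite -sgz_eq0 h sgz_eq0. Qed.

Lemma agree_size_le (F1 F2 : rcfType) (f1 : {rmorphism D -> F1})
    (f2 : {rmorphism D -> F2}) (P : {poly D}) :
  agree P f1 f2 -> (size (map_poly f1 P) <= size (map_poly f2 P))%N.
Proof.
move=> hT; apply/leq_sizeP => j hj; rewrite coef_map.
have [jP|Pj] := ltnP j (size P); last by rewrite nth_default //; exact: rmorph0.
apply/eqP; rewrite /= (agree_eq0 (hT _ (mem_nth 0 jP))).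
by have/leq_sizeP/(_ j hj) := leqnn (size (map_poly f2 P)); rewrite coef_map => ->.
Qed.

Section TwoMorphisms.
Variables (F1 F2 : rcfType).
Variables (f1 : {rmorphism D -> F1}) (f2 : {rmorphism D -> F2}).

Lemma agree_size (P : {poly D}) :
  agree P f1 f2 -> size (map_poly f1 P) = size (map_poly f2 P).
Proof.
by move=> hT; apply/eqP; rewrite eqn_leq !agree_size_le //; apply: agree_sym.
Qed.

Lemma agree_coef (P : {poly D}) i :
  agree P f1 f2 -> sgz (map_poly f1 P)`_i = sgz (map_poly f2 P)`_i.
Proof.
move=> hT; rewrite !coef_map.
have [jP|Pj] := ltnP i (size P); first by apply: hT; rewrite mem_nth.
by rewrite nth_default //= !rmorph0 !sgz0.
Qed.

Lemma agree_lead (P : {poly D}) :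
  agree P f1 f2 -> sgz (lead_coef (map_poly f1 P)) = sgz (lead_coef (map_poly f2 P)).
Proof. by move=> hT; rewrite !lead_coefE (agree_size hT) agree_coef. Qed.

Lemma agree_poly0 (P : {poly D}) :
  agree P f1 f2 -> (map_poly f1 P == 0) = (map_poly f2 P == 0).
Proof. by move=> hT; rewrite -!size_poly_eq0 (agree_size hT). Qed.

Lemma agree_crossR (P : {poly D}) :
  agree P f1 f2 -> crossR (map_poly f1 P) = crossR (map_poly f2 P).
Proof.
move=> hT; rewrite /crossR /variation /sgp_minfty /sgp_pinfty.
rewrite -!sgz_cp0 !(sgzM, sgz_sgr, sgzX, sgzN, sgz1) (agree_size hT).
by rewrite (agree_lead hT).
Qed.

End TwoMorphisms.

Lemma ltn_measure (a b c : nat) (u v : bool) :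
  (a < b)%N -> ((c + a).*2 + u < (c + b).*2 + v)%N.
Proof. by case: u v => [] []; lia. Qed.

Lemma cindexR_decided (P Q : {poly D}) : exists T : seq D,
  forall (F1 F2 : rcfType) (f1 : {rmorphism D -> F1}) (f2 : {rmorphism D -> F2}),
    agree T f1 f2 ->
    cindexR (map_poly f1 Q) (map_poly f1 P) = cindexR (map_poly f2 Q) (map_poly f2 P).
Proof.
(* Exchanging [P] and [Q] keeps the sum of the sizes and clears the extra bit; the other two
   recursive calls lower the sum. *)
have [n] := ubnP ((size P + size Q).*2 + (size P < size Q)).
elim: n P Q => // n IHn P Q /ltnSE lePQ.
have [->|Q0] := eqVneq Q 0.
  by exists [::] => *; rewrite !rmorph0 !cindexR0p.
have [->|P0] := eqVneq P 0.
  by exists [::] => *; rewrite !rmorph0 !cindexRpC.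
have sP : (0 < size P)%N by rewrite size_poly_gt0.
have sQ : (0 < size Q)%N by rewrite size_poly_gt0.
set a := lead_coef Q.
(* A morphism may kill the leading coefficient [a]; then [Q] and [Q'] have the same image. Listing
   [a] makes both fields fall in the same case. *)
pose Q' := Q - a *: 'X^((size Q).-1).
have sQ' : (size Q' < size Q)%N.
  rewrite -[in X in (_ < X)%N](prednK sQ) ltnS.
  apply/leq_sizeP => j; rewrite leq_eqVlt => /orP[/eqP<-|hj].
    by rewrite coefB coefZ coefXn eqxx mulr1 subrr.
  by rewrite coefB coefZ coefXn gtn_eqF // mulr0 subr0 nth_default // -(prednK sQ).
have [T1 HT1] : exists T : seq D, forall (F1 F2 : rcfType) (f1 : {rmorphism D -> F1})
    (f2 : {rmorphism D -> F2}), agree T f1 f2 ->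
    cindexR (map_poly f1 Q') (map_poly f1 P) = cindexR (map_poly f2 Q') (map_poly f2 P).
  apply: IHn; apply: leq_trans lePQ.
  exact: ltn_measure.
have deg0 (F : rcfType) (f : {rmorphism D -> F}) : f a = 0 ->
    map_poly f Q = map_poly f Q'.
  by move=> fa0; rewrite rmorphB /= map_polyZ /= fa0 scale0r subr0.
have nz (F : rcfType) (f : {rmorphism D -> F}) : f a != 0 ->
    map_poly f Q != 0 /\ size (map_poly f Q) = size Q.
  move=> fa0; have sz : size (map_poly f Q) = size Q by rewrite size_map_poly_id0.
  by split=> //; rewrite -size_poly_eq0 sz -lt0n.
have [PQ|QP] := ltnP (size P) (size Q).
  have [|T2 HT2] := IHn Q P.
    apply: leq_trans lePQ; rewrite PQ [(size Q < _)%N]ltnNge (ltnW PQ).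
    by rewrite [(size Q + _)%N]addnC addn0 addn1.
  exists (a :: T1 ++ T2 ++ (P * Q)%R) => F1 F2 f1 f2 hT.
  have ha : sgz (f1 a) = sgz (f2 a) by apply: hT; rewrite mem_head.
  have : agree (T1 ++ T2 ++ (P * Q)%R) f1 f2 by move=> t ht; apply: hT; rewrite inE ht orbT.
  case/agree_cat => hT1 /agree_cat[hT2 hT3].
  have [fa0|fa0] := eqVneq (f1 a) 0.
    have fa0' : f2 a = 0 by apply/eqP; rewrite -(agree_eq0 ha) fa0.
    by rewrite !deg0 //; apply: HT1.
  have fa0' : f2 a != 0 by rewrite -(agree_eq0 ha).
  have [q1 s1] := nz _ _ fa0; have [q2 s2] := nz _ _ fa0'.
  have lt1 : (size (map_poly f1 P) < size (map_poly f1 Q))%N.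
    by rewrite s1; apply: leq_ltn_trans PQ; apply: size_poly.
  have lt2 : (size (map_poly f2 P) < size (map_poly f2 Q))%N.
    by rewrite s2; apply: leq_ltn_trans PQ; apply: size_poly.
  rewrite (cindexR_swap q1 lt1) (cindexR_swap q2 lt2).
  by rewrite -!rmorphM (agree_crossR hT3) (HT2 _ _ _ _ hT2).
(* In the top degree [a ^+ 2 *: P] and [h * Q] both have coefficient [a ^+ 2 * lead_coef P], so the
   leading term cancels without a division. *)
pose h := (a * lead_coef P) *: 'X^(size P - size Q).
pose P1 := a ^+ 2 *: P - h * Q.
have sP1 : (size P1 < size P)%N.
  rewrite -[in X in (_ < X)%N](prednK sP) ltnS.
  apply/leq_sizeP => j hj; rewrite coefB coefZ /h -scalerAl coefZ coefXnM.
  rewrite ltnNge; have -> /= : (size P - size Q <= j)%N.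
    by apply: leq_trans hj; rewrite -subn1 leq_sub2l.
  move: hj; rewrite leq_eqVlt => /orP[/eqP<-|hj].
    have -> : ((size P).-1 - (size P - size Q) = (size Q).-1)%N.
      by rewrite -subn1 subnAC subKn // subn1.
    by rewrite -!lead_coefE -/a expr2 mulrAC subrr.
  have jP : (size P <= j)%N by rewrite -(prednK sP).
  rewrite !nth_default ?mulr0 ?subr0 // leq_subRL ?(leq_trans (leq_subr _ _) jP) //.
  by rewrite subnK.
have [|T2 HT2] := IHn P1 Q.
  apply: leq_trans lePQ.
  by rewrite ![(_ + size Q)%N]addnC; apply: ltn_measure.
exists (a :: T1 ++ T2 ++ (P * Q)%R ++ (P1 * Q)%R) => F1 F2 f1 f2 hT.
have ha : sgz (f1 a) = sgz (f2 a) by apply: hT; rewrite mem_head.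
have : agree (T1 ++ T2 ++ (P * Q)%R ++ (P1 * Q)%R) f1 f2.
  by move=> t ht; apply: hT; rewrite inE ht orbT.
case/agree_cat => hT1 /agree_cat[hT2 /agree_cat[hT3 hT4]].
have [fa0|fa0] := eqVneq (f1 a) 0.
  have fa0' : f2 a = 0 by apply/eqP; rewrite -(agree_eq0 ha) fa0.
  by rewrite !deg0 //; apply: HT1.
have fa0' : f2 a != 0 by rewrite -(agree_eq0 ha).
have [q1 s1] := nz _ _ fa0; have [q2 s2] := nz _ _ fa0'.
have E (F : rcfType) (f : {rmorphism D -> F}) :
    f a ^+ 2 *: map_poly f P - map_poly f h * map_poly f Q = map_poly f P1.
  by rewrite [RHS]rmorphB /= [map_poly f (_ *: P)]map_polyZ rmorphXn [map_poly f (h * Q)]rmorphM.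
rewrite (@cindexR_step _ (f1 a) _ _ (map_poly f1 h)) //.
rewrite (@cindexR_step _ (f2 a) _ _ (map_poly f2 h)) // !E.
by rewrite -!rmorphM (agree_crossR hT3) (agree_crossR hT4) (HT2 _ _ _ _ hT2).
Qed.

Lemma decided_all (I : eqType) (s : seq I)
    (Phi : I -> forall F1 F2 : rcfType, {rmorphism D -> F1} -> {rmorphism D -> F2} -> Prop) :
  (forall i, exists T : seq D, forall (F1 F2 : rcfType) (f1 : {rmorphism D -> F1})
      (f2 : {rmorphism D -> F2}), agree T f1 f2 -> Phi i F1 F2 f1 f2) ->
  exists T : seq D, forall (F1 F2 : rcfType) (f1 : {rmorphism D -> F1})
      (f2 : {rmorphism D -> F2}), agree T f1 f2 -> forall i, i \in s -> Phi i F1 F2 f1 f2.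
Proof.
move=> H; elim: s => [|i s [T HT]]; first by exists [::].
have [T' HT'] := H i; exists (T' ++ T) => F1 F2 f1 f2 /agree_cat[h' h] j.
by rewrite inE => /predU1P[->|js]; [apply: HT' | apply: HT].
Qed.

(* The Tarski queries determine the sign counts because [ctmat] is invertible over
   the rationals, independently of the two fields. *)
Lemma constraints1_eq (F1 F2 : rcfType) (z1 : seq F1) (z2 : seq F2)
    (s1 : seq {poly F1}) (s2 : seq {poly F2}) (k : nat) :
  size s1 = k -> size s2 = k ->
  (forall sc, sc \in sg_tab k -> taq z1 (poly_comb s1 sc) = taq z2 (poly_comb s2 sc)) ->
  constraints z1 s1 (nseq k 1) = constraints z2 s2 (nseq k 1).
Proof.
move=> h1 h2 h.
pose tv (F : rcfType) z s : 'rV[int]_(3 ^ k) :=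
  \row_(i < 3 ^ k) (taq z (map (@poly_comb F s) (sg_tab k))`_i).
pose cv (F : rcfType) z s : 'rV[int]_(3 ^ k) :=
  \row_(i < 3 ^ k) ((@constraints F z s (nth [::] (sg_tab k) i))%:~R : int).
have tvE (F : rcfType) z s : size s = k -> tv F z s = cv F z s *m ctmat k.
  by rewrite /tv /cv => <-; apply: tvec_cvec.
have tv12 : tv F1 z1 s1 = tv F2 z2 s2.
  apply/rowP => i; rewrite !mxE !(nth_map [::]) ?size_sg_tab //.
  by apply: h; rewrite mem_nth // size_sg_tab.
have /(congr1 (map_mx (intr : int -> rat))) : cv F1 z1 s1 *m ctmat k = cv F2 z2 s2 *m ctmat k.
  by rewrite -!tvE.
rewrite !map_mxM /= => /(can_inj (mulmxK (ctmat_unit rat k))) /matrixP E.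
(* Entry 0 of the sign table is the condition that all signs are positive. *)
have k3 : (0 < 3 ^ k)%N by rewrite expn_gt0.
have := E ord0 (Ordinal k3); rewrite !mxE !intz /=.
have -> : nth [::] (sg_tab k) 0 = nseq k 1.
  elim: (k) => //= k' <-; have := size_sg_tab_neq0 k'.
  by case: (sg_tab k').
by move=> /intr_inj [].
Qed.

Lemma map_poly_comb (F : rcfType) (f : {rmorphism D -> F}) (S : seq {poly D}) (sc : seq int) :
  poly_comb (map (map_poly f) S) sc =
  map_poly f (\prod_(i < size S) S`_i ^+ comb_exp sc`_i).
Proof.
rewrite /poly_comb rmorph_prod /=.
rewrite -(big_mkord xpredT (fun i => (map (map_poly f) S)`_i ^+ comb_exp sc`_i)).
rewrite -(big_mkord xpredT (fun i => map_poly f (S`_i ^+ comb_exp sc`_i))) size_map.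
by apply: eq_big_nat => i /andP[_ ilt]; rewrite (nth_map 0) // rmorphXn.
Qed.

Lemma root_pos_decided (P : {poly D}) (S : seq {poly D}) : exists T : seq D,
  forall (F1 F2 : rcfType) (f1 : {rmorphism D -> F1}) (f2 : {rmorphism D -> F2}),
    agree T f1 f2 -> map_poly f1 P != 0 ->
    (exists x, root (map_poly f1 P) x /\ forall q, q \in S -> 0 < (map_poly f1 q).[x]) ->
    exists x, root (map_poly f2 P) x /\ forall q, q \in S -> 0 < (map_poly f2 q).[x].
Proof.
pose C sc := \prod_(i < size S) S`_i ^+ comb_exp (sc`_i : int).
have [T HT] := @decided_all _ (sg_tab (size S))
  (fun sc F1 F2 f1 f2 =>
     cindexR (map_poly f1 (P^`() * C sc)) (map_poly f1 P) =
     cindexR (map_poly f2 (P^`() * C sc)) (map_poly f2 P))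
  (fun sc => cindexR_decided P (P^`() * C sc)).
exists ((P : seq D) ++ T) => F1 F2 f1 f2 /agree_cat[hP /HT{}HT] P1 [x [rx Sx]].
have P2 : map_poly f2 P != 0 by rewrite -(agree_poly0 hP).
have E : constraints (rootsR (map_poly f1 P)) (map (map_poly f1) S) (nseq (size S) 1) =
         constraints (rootsR (map_poly f2 P)) (map (map_poly f2) S) (nseq (size S) 1).
  apply: constraints1_eq; rewrite ?size_map // => sc /HT.
  by rewrite !map_poly_comb !taq_taqR /taqR !changes_mods_cindex !deriv_map -!rmorphM.
have /(ccount_weakP _ P1) : exists x, ((map_poly f1 P).[x] == 0) &&
    \big[andb/true]_(q <- map (map_poly f1) S) (q.[x] > 0).
  exists x; rewrite -rootE rx big_map big_all; apply/allP => q; exact: Sx.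
rewrite -constraints1P size_map E ltr0n => c2.
have /(ccount_weakP _ P2)[y /andP[ry]] : 0 < ccount_weak (map_poly f2 P) (map (map_poly f2) S).
  by rewrite -constraints1P size_map ltr0n.
rewrite big_map big_all => /allP Sy; exists y; split=> // q; exact: Sy.
Qed.

(** The equations merge into [P = 0], with [P] their sum of squares. If [P] maps to 0, strict
    inequalities remain; they are solvable exactly when they hold near plus infinity, near minus
    infinity, or at a root of the derivative [B] of their product, by Rolle between two roots of the
    product. *)
Lemma system_decided (Z L : seq {poly D}) : exists T : seq D,
  forall (F1 F2 : rcfType) (f1 : {rmorphism D -> F1}) (f2 : {rmorphism D -> F2}),
    agree T f1 f2 ->
    (exists x, (forall p, p \in Z -> (map_poly f1 p).[x] = 0) /\
               (forall q, q \in L -> 0 < (map_poly f1 q).[x])) ->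
    exists x, (forall p, p \in Z -> (map_poly f2 p).[x] = 0) /\
              (forall q, q \in L -> 0 < (map_poly f2 q).[x]).
Proof.
pose P := \sum_(p <- Z) p ^+ 2.
pose B := (\prod_(q <- L) q)^`().
have [T1 HT1] := root_pos_decided P L.
have [T2 HT2] := root_pos_decided B L.
have [T3 HT3] := @decided_all _ L (fun q F1 F2 f1 f2 => agree q f1 f2)
  (fun q => ex_intro _ (q : seq D) (fun F1 F2 f1 f2 h => h)).
have PE (F : rcfType) (f : {rmorphism D -> F}) x :
    reflect (forall p, p \in Z -> (map_poly f p).[x] = 0) ((map_poly f P).[x] == 0).
  rewrite rmorph_sum horner_sum psumr_eq0; last first.
    by move=> p _; rewrite /= rmorphXn horner_exp sqr_ge0.
  apply: (iffP allP) => [h p /h /=|h p /h /= E].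
    by rewrite rmorphXn horner_exp sqrf_eq0 => /eqP.
  by rewrite rmorphXn horner_exp E expr0n.
have BE (F : rcfType) (f : {rmorphism D -> F}) :
    bounding_poly (map (map_poly f) L) = map_poly f B.
  by rewrite /bounding_poly /B -deriv_map rmorph_prod big_map.
exists ((P : seq D) ++ (B : seq D) ++ T1 ++ T2 ++ T3) => F1 F2 f1 f2.
case/agree_cat=> hP /agree_cat[hB] /agree_cat[/HT1{}HT1] /agree_cat[/HT2{}HT2 /HT3{}HT3].
move=> [x [/PE Zx Lx]].
have [P1|P1] := eqVneq (map_poly f1 P) 0; last first.
  have [|y [ry Ly]] := HT1 P1; first by exists x.
  by exists y; split=> //; apply/PE.
have P2 : map_poly f2 P = 0 by apply/eqP; rewrite -(agree_poly0 hP) P1.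
suff [y Ly] : exists y, \big[andb/true]_(q <- map (map_poly f2) L) (q.[y] > 0).
  exists y; split; first by apply/PE; rewrite P2 horner0.
  by move: Ly; rewrite big_map big_all => /allP.
have L1 : exists y, \big[andb/true]_(q <- map (map_poly f1) L) (q.[y] > 0).
  by exists x; rewrite big_map big_all; apply/allP.
have lead1 : (forall q, q \in L -> 0 < lead_coef (map_poly f1 q)) ->
    exists y, \big[andb/true]_(q <- map (map_poly f2) L) (q.[y] > 0).
  move=> h; apply/bounding_polyP/Or31.
  rewrite big_map big_all; apply/allP => q qL.
  by rewrite -sgz_cp0 -(agree_lead (HT3 _ qL)) sgz_cp0 h.
move: L1 => /bounding_polyP[||[y /andP[By Ly]]].
- by rewrite big_map big_all => /allP; apply: lead1.
- rewrite big_map big_all => /allP h; apply/bounding_polyP/Or32.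
  rewrite big_map big_all; apply/allP => q qL.
  have := h q qL; rewrite -!sgz_cp0 !sgzM !sgzX !sgzN !sgz1.
  by rewrite (agree_lead (HT3 _ qL)) (agree_size (HT3 _ qL)).
have {}Ly : forall q, q \in L -> 0 < (map_poly f1 q).[y].
  by move: Ly; rewrite big_map big_all => /allP.
have [B1|B1] := eqVneq (map_poly f1 B) 0; last first.
  have [|t [rt Lt]] := HT2 B1; first by exists y; rewrite rootE -BE.
  by exists t; rewrite big_map big_all; apply/allP.
(* The product has zero derivative and does not vanish at [y], so every factor is a constant, equal
   to its own leading coefficient. *)
apply: lead1 => q qL.
have s1 : (size (\prod_(q <- map (map_poly f1) L) q)%R <= 1)%N.
  by rewrite polyorder.derivn_poly0 derivn1 -/(bounding_poly _) BE B1.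
have s2 : size (\prod_(q <- map (map_poly f1) L) q)%R == 1%N.
  rewrite eqn_leq s1 size_poly_gt0 prodf_seq_neq0; apply/allP => _ /mapP[r rL ->] /=.
  by apply/eqP => E; have := Ly r rL; rewrite E horner0 ltxx.
move: s2 => /size_prod_eq1 /(_ _ (map_f _ qL)) s2.
have := Ly q qL; rewrite (size1_polyC (p := map_poly f1 q)) ?s2 //.
by rewrite hornerC lead_coefC.
Qed.

Lemma sign_decided (S : seq {poly D}) : exists T : seq D,
  forall (F1 F2 : rcfType) (f1 : {rmorphism D -> F1}) (f2 : {rmorphism D -> F2}),
    agree T f1 f2 -> forall x, exists y,
    forall p, p \in S -> sgz (map_poly f1 p).[x] = sgz (map_poly f2 p).[y].
Proof.
pose k := size S.
(* A sign condition on [S] is coded by three masks, for the members that vanish, are positive, are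
   negative. There are finitely many codes, so one list decides them all. *)
pose Z (m : k.-tuple bool * k.-tuple bool * k.-tuple bool) := mask m.1.1 S.
pose L (m : k.-tuple bool * k.-tuple bool * k.-tuple bool) :=
  mask m.1.2 S ++ map -%R (mask m.2 S).
have [T HT] := decided_all (enum {: k.-tuple bool * k.-tuple bool * k.-tuple bool})
  (fun m => system_decided (Z m) (L m)).
exists T => F1 F2 f1 f2 /HT{}HT x.
pose s0 (p : {poly D}) := (map_poly f1 p).[x] == 0.
pose s1 (p : {poly D}) := 0 < (map_poly f1 p).[x].
pose s2 (p : {poly D}) := (map_poly f1 p).[x] < 0.
have [|y] := HT (map_tuple s0 (in_tuple S), map_tuple s1 (in_tuple S),
  map_tuple s2 (in_tuple S)) (mem_enum _ _).
  exists x; rewrite /Z /L /= -!filter_mask; split=> [p|q].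
    by rewrite mem_filter => /andP[/eqP].
  rewrite mem_cat => /orP[|/mapP[r]]; rewrite mem_filter => /andP[h _] //.
  by move=> ->; rewrite rmorphN hornerN oppr_gt0.
rewrite /Z /L /= -!filter_mask => -[y0 y1]; exists y => p pS.
case: (sgzP (map_poly f1 p).[x]) => hp; apply/esym/eqP; rewrite sgz_cp0.
- by rewrite y0 // mem_filter pS andbT /s0 hp.
- by rewrite y1 // mem_cat mem_filter pS andbT /s1 hp.
- rewrite -oppr_gt0 -hornerN -rmorphN; apply: y1; rewrite mem_cat; apply/orP; right.
  by apply: map_f; rewrite mem_filter pS /s2 hp.
Qed.

End Transfer.

(** * Transfer in several variables, over iterated polynomial rings *)

Fixpoint itp (D : comNzRingType) (n : nat) : comNzRingType :=
  if n is m.+1 then {poly itp D m} else D.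

(* [a 0] is the value of the outermost of the [n] variables. *)
Fixpoint evl (D A : comNzRingType) (f : {rmorphism D -> A}) (n : nat) (a : nat -> A) :
    {rmorphism itp D n -> A} :=
  if n is m.+1 return {rmorphism itp D n -> A} then
    horner_morph (fun x => mulrC (a 0%N) (evl f m (fun i => a i.+1) x))
  else f.

Lemma evlS (D A : comNzRingType) (f : {rmorphism D -> A}) (n : nat) (a : nat -> A)
    (p : {poly itp D n}) :
  evl f n.+1 a p = (map_poly (evl f n (fun i => a i.+1)) p).[a 0%N].
Proof. by []. Qed.

(** Nesting univariate rings lets [sign_decided] eliminate the outermost variable, with the
    remaining ones in the coefficients; induction treats the list it returns. *)
Lemma evl_sign_decided (D : comNzRingType) (n : nat) (S : seq (itp D n)) :
  exists T : seq D,
  forall (F1 F2 : rcfType) (f1 : {rmorphism D -> F1}) (f2 : {rmorphism D -> F2}),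
    agree T f1 f2 -> forall a1 : nat -> F1, exists a2 : nat -> F2,
    forall p, p \in S -> sgz (evl f1 n a1 p) = sgz (evl f2 n a2 p).
Proof.
elim: n S => [|n IHn] S.
  by exists S => F1 F2 f1 f2 hT a1; exists (fun=> 0).
have [T' HT'] := sign_decided S; have [T HT] := IHn T'.
exists T => F1 F2 f1 f2 /HT{}HT a1; have [a2 /HT'{}HT'] := HT (fun i => a1 i.+1).
have [y hy] := HT' (a1 0%N).
by exists (fun i => if i is j.+1 then a2 j else y).
Qed.

Lemma evl_comp (D A A' : comNzRingType) (h : {rmorphism A -> A'})
    (f : {rmorphism D -> A}) (g : {rmorphism D -> A'}) (n : nat)
    (a : nat -> A) (b : nat -> A') :
  (forall d, h (f d) = g d) -> (forall i, (i < n)%N -> h (a i) = b i) ->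
  forall p, h (evl f n a p) = evl g n b p.
Proof.
move=> hfg; elim: n a b => [|n IHn] a b hab p; first exact: hfg.
rewrite !evlS -horner_map hab //; congr (_.[_]).
by apply/polyP => i; rewrite !coef_map /=; apply: IHn => j jn; apply: hab.
Qed.

(** Writing [p] as [p] composed with ['X], a morphism is determined by its restriction to constants
    and by its value at ['X]; the point [a] collects these values. *)
Lemma itp_morphism (D A : comNzRingType) (n : nat) (h : {rmorphism itp D n -> A}) :
  exists (f : {rmorphism D -> A}) (a : nat -> A), forall p, h p = evl f n a p.
Proof.
elim: n h => [|n IHn] h; first by exists h, (fun=> 0).
pose hC : {rmorphism itp D n -> A} := h \o (polyC : itp D n -> {poly itp D n}).
have [f [a fa]] := IHn hC.
exists f, (fun i => if i is j.+1 then a j else h ('X : {poly itp D n})) => p.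
rewrite evlS /= -[p in LHS]comp_polyXr /comp_poly.
rewrite -(horner_map h); congr (_.[_]).
by apply/polyP => i; rewrite !coef_map /= -fa.
Qed.

(** The witness is uniform in the target ring, so one element can be evaluated in two rings at
    once. *)
Lemma evl_const (D : comNzRingType) (n : nat) (d : D) : exists p : itp D n,
  forall (A : comNzRingType) (f : {rmorphism D -> A}) (a : nat -> A), evl f n a p = f d.
Proof.
elim: n => [|n [p hp]]; first by exists d.
by exists (p%:P : {poly itp D n}) => A f a; rewrite evlS map_polyC hornerC /= hp.
Qed.

Lemma evl_var (D : comNzRingType) (n i : nat) : (i < n)%N -> exists p : itp D n,
  forall (A : comNzRingType) (f : {rmorphism D -> A}) (a : nat -> A), evl f n a p = a i.
Proof.
elim: n i => // n IHn [|i] lin.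
  by exists ('X : {poly itp D n}) => A f a; rewrite evlS map_polyX hornerX.
have [p hp] := IHn i lin.
by exists (p%:P : {poly itp D n}) => A f a; rewrite evlS map_polyC hornerC /= hp.
Qed.

Lemma itp_countable (D : comNzRingType) (n : nat) :
  (exists g : D -> nat, injective g) -> exists g : itp D n -> nat, injective g.
Proof.
move=> hD; elim: n => // n [g ginj].
exists (fun p : {poly itp D n} => pickle (map g p)) => p q.
by move=> /(pcan_inj (@pickleK _)) /(inj_map ginj) /val_inj.
Qed.

(** * Prime cones *)

(** [Zorn_bigcup] also asks for the union of the empty chain. Applying it to the sets whose union
    with [T0] satisfies [P] turns that case into [P T0]. *)
Lemma zorn_above (U : Type) (P : set (set U)) (T0 : set U) : P T0 ->
  (forall F, F !=set0 -> F `<=` P -> total_on F subset -> P (\bigcup_(X in F) X)) ->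
  exists A, [/\ P A, T0 `<=` A & forall B, A `<=` B -> P B -> B `<=` A].
Proof.
move=> PT0 Pchain.
have [|A [PA Amax]] := @Zorn_bigcup U [set X | P (X `|` T0)].
  move=> F FP Ftot; have [F0|F0] := pselect (F !=set0); last first.
    rewrite /= (_ : \bigcup_(X in F) X = set0) ?set0U //.
    by rewrite -subset0 => x [X FX _]; case: F0; exists X.
  rewrite /=.
  have -> : \bigcup_(X in F) X `|` T0 = \bigcup_(X in [set Y `|` T0 | Y in F]) X.
    rewrite predeqE => x; split.
      case=> [[X FX Xx]|T0x].
        by exists (X `|` T0); [exists X | left].
      by have [X FX] := F0; exists (X `|` T0); [exists X | right].
    by case=> _ [X FX <-] [Xx|T0x]; [left; exists X | right].
  apply: Pchain.
  - by have [X FX] := F0; exists (X `|` T0); exists X.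
  - by move=> _ [X FX <-]; apply: FP.
  - move=> _ _ [X FX <-] [Y FY <-].
    by have [h|h] := Ftot _ _ FX FY; [left|right]; apply: setSU.
exists (A `|` T0); split=> // B AB PB x Bx.
have BT0 : B `|` T0 = B by apply: setUidl; apply: subset_trans AB; right.
apply: contrapT => nAx; apply: (Amax B); last by rewrite /= BT0.
split; first by move=> y Ay; apply: AB; left.
by move=> BA; apply: nAx; left; apply: BA.
Qed.

Definition preordering (A : comNzRingType) (T : set A) : Prop :=
  [/\ forall x y, T x -> T y -> T (x + y),
      forall x y, T x -> T y -> T (x * y) &
      forall x, T (x ^+ 2)].

Definition cone_supp (A : comNzRingType) (T : set A) : set A :=
  [set x | T x /\ T (- x)].

(** A point of the real spectrum of [A]: an ordering of the quotient by a prime ideal, pulled back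
    to [A]. *)
Definition prime_cone (A : comNzRingType) (T : set A) : Prop :=
  [/\ preordering T, forall x, T x \/ T (- x), ~ T (-1) &
      forall x y, cone_supp T (x * y) -> cone_supp T x \/ cone_supp T y].

(** A preordering maximal among those avoiding [- M] is prime. If totality or primality of the
    support failed, two elements could be adjoined, each producing some [- m]; multiplying the two
    relations puts [- (m * m')] in [T]. *)
Lemma prime_cone_exists (A : comNzRingType) (T0 M : set A) :
  preordering T0 -> M 1 -> M `<=` T0 ->
  (forall x y, M x -> M y -> M (x * y)) ->
  (forall m, M m -> ~ T0 (- m)) ->
  exists T, [/\ prime_cone T, T0 `<=` T & forall m, M m -> ~ T (- m)].
Proof.
move=> pT0 M1 MT0 MM MnT0.
have [|F F0 FP Ftot|T [[pT TM] T0T Tmax]] :=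
  @zorn_above A [set T | preordering T /\ forall m, M m -> ~ T (- m)] T0.
- by split.
- have [X0 FX0] := F0.
  split; last by move=> m Mm [X /FP[_ +] Xm] => /(_ m Mm).
  split=> [x y [X FX Xx] [Y FY Yy]|x y [X FX Xx] [Y FY Yy]|x].
  + have [h|h] := Ftot _ _ FX FY.
      by exists Y => //; have [[Ya _ _] _] := FP _ FY; apply: Ya; first exact: h.
    by exists X => //; have [[Ya _ _] _] := FP _ FX; apply: Ya; last exact: h.
  + have [h|h] := Ftot _ _ FX FY.
      by exists Y => //; have [[_ Ya _] _] := FP _ FY; apply: Ya; first exact: h.
    by exists X => //; have [[_ Ya _] _] := FP _ FX; apply: Ya; last exact: h.
  + by exists X0 => //; have [[_ _ Ya] _] := FP _ FX0.
have [TD TMul Tsq] := pT.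
have T_0 : T 0 by rewrite -[0](expr0n _ 2); apply: Tsq.
have T_1 : T 1 by rewrite -[1](expr1n _ 2); apply: Tsq.
have MT m : M m -> T m by move=> /MT0/T0T.
(* Adjoining an element outside [T] must produce some [- m]. *)
have adj a : ~ T a -> exists m t s, [/\ M m, T t, T s & - m = t + a * s].
  move=> nTa; apply: contrapT => H; apply: nTa.
  apply: (Tmax [set x | exists t s, [/\ T t, T s & x = t + a * s]]).
  - by move=> x Tx; exists x, 0; rewrite mulr0 addr0.
  - split; first split.
    + move=> _ _ [t [s [Tt Ts ->]]] [t' [s' [Tt' Ts' ->]]].
      by exists (t + t'), (s + s'); split; [apply: (TD)|apply: (TD)|ring].
    + move=> _ _ [t [s [Tt Ts ->]]] [t' [s' [Tt' Ts' ->]]].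
      exists (t * t' + a ^+ 2 * (s * s')), (t * s' + s * t').
      by split; [apply: (TD); apply: (TMul) => //; apply: (TMul)|apply: (TD); apply: (TMul)|ring].
    + by move=> x; exists (x ^+ 2), 0; rewrite mulr0 addr0.
    + by move=> m Mm [t [s [Tt Ts E]]]; apply: H; exists m, t, s.
  - by exists 0, 1; rewrite mulr1 add0r.
have tot x : T x \/ T (- x).
  apply: contrapT => /not_orP[/adj[m [t [s [Mm Tt Ts E]]]] /adj[m' [t' [s' [Mm' Tt' Ts' E']]]]].
  apply: (TM (m * m')); first exact: MM.
  have -> : - (m * m') = (t * t' + (t * m' + t' * m)) + x ^+ 2 * (s * s').
    have xs : x * s = - m - t by rewrite E; ring.
    have xs' : x * s' = m' + t' by rewrite -[m']opprK E'; ring.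
    by rewrite expr2 mulrACA xs xs'; ring.
  apply: (TD); last by apply: (TMul) => //; apply: (TMul).
  by apply: (TD); [apply: (TMul)|apply: (TD); apply: (TMul) => //; apply: (MT)].
exists T; split=> //; split=> //; first exact: TM.
move=> x y [Txy Tnxy]; apply: contrapT => /not_orP[nx ny].
(* The support is stable under sign change, so each factor may be replaced by its opposite to lie
   outside [T]. *)
wlog nTx : x Txy Tnxy nx / ~ T x.
  move=> H; have [Tx|Tx] := pselect (T x); last exact: (H x).
  apply: (H (- x)); rewrite ?mulNr ?opprK //.
    by case=> Tnx _; apply: nx.
  by move=> Tnx; apply: nx.
wlog nTy : y Txy Tnxy ny / ~ T y.
  move=> H; have [Ty|Ty] := pselect (T y); last exact: (H y).
  apply: (H (- y)); rewrite ?mulrN ?opprK //.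
    by case=> Tny _; apply: ny.
  by move=> Tny; apply: ny.
have [m [t [s [Mm Tt Ts E]]]] := adj _ nTx.
have [m' [t' [s' [Mm' Tt' Ts' E']]]] := adj _ nTy.
apply: (TM (m * m')); first exact: MM.
have -> : - (m * m') = (t * t' + (t * m' + t' * m)) + (- (x * y)) * (s * s').
  have xs : x * s = - m - t by rewrite E; ring.
  have xs' : y * s' = - m' - t' by rewrite E'; ring.
  by rewrite mulNr mulrACA xs xs'; ring.
apply: (TD); last by apply: (TMul) => //; apply: (TMul).
by apply: (TD); [apply: (TMul)|apply: (TD); apply: (TMul) => //; apply: (MT)].
Qed.

(** * The residue domain of a prime cone inside an algebraically closed field *)

Lemma pcancel_of_injective (T : Type) (g : T -> nat) : injective g ->
  exists h : nat -> option T, pcancel g h.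
Proof.
move=> ginj.
exists (fun k => if pselect (exists x, g x = k) is left e then Some (projT1 (cid e)) else None).
move=> x; case: pselect => [e|]; last by case; exists x.
by congr Some; apply: ginj; apply: (projT2 (cid e)).
Qed.

Lemma idomain_structure (Q : comNzRingType) :
  (forall x y : Q, x * y = 0 -> (x == 0) || (y == 0)) ->
  exists (I : idomainType) (h : {rmorphism Q -> I}), bijective h.
Proof.
move=> Qint.
pose un : {pred Q} := fun x => `[< exists y, y * x = 1 >].
pose iv (x : Q) : Q :=
  if pselect (exists y, y * x = 1) is left e then projT1 (cid e) else x.
have ivV : {in un, left_inverse 1 iv *%R}.
  by move=> x /asboolP ux; rewrite /iv; case: pselect => // e; apply: (projT2 (cid e)).
have unP x y : y * x = 1 -> un x by move=> e; apply/asboolP; exists y.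
have iv_out : {in [predC un], iv =1 id}.
  by move=> x /asboolP nux; rewrite /iv; case: pselect.
pose Um := GRing.ComNzRing_hasMulInverse.Build Q ivV unP iv_out.
pose U : comUnitRingType := HB.pack Q Um.
pose Im := GRing.ComUnitRing_isIntegral.Build U Qint.
pose I : idomainType := HB.pack U Im.
by exists I, (idfun : {rmorphism Q -> Q}); exists id.
Qed.

(** A fraction is coded by its chosen numerator and denominator, so the fraction field is countable
    and [countable_algebraic_closure] applies. *)
Lemma idomain_closed_field (I : idomainType) (g : I -> nat) : injective g ->
  exists (C : closedFieldType) (h : {rmorphism I -> C}), injective h.
Proof.
move=> ginj.
pose gK (x : {fraction I}) : nat := pickle (g (repr x).1, g (repr x).2).
have gKinj : injective gK.
  move=> x y /(pcan_inj (@pickleK _)) [/ginj e1 /ginj e2].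
  rewrite -[x]reprK -[y]reprK; congr (\pi_({fraction I})%qT _); apply: val_inj.
  by case: (repr x) (repr y) e1 e2 => [[a b] ?] [[c d] ?] /= -> ->.
have [hK gKK] := pcancel_of_injective gKinj.
pose Cm := Choice_isCountable.Build {fraction I} gKK.
pose K : countFieldType := HB.pack {fraction I} Cm.
have [C [h _]] := countable_algebraic_closure K.
pose t : {rmorphism I -> K} := @tofrac I.
exists C, (h \o t).
by move=> x y /= /fmorph_inj /eqP; rewrite tofrac_eq => /eqP.
Qed.

(** Since [a] or [- a] lies in [T], the support is stable under multiplication by [a]; it is thus a
    prime ideal, and [C] contains the quotient domain. *)
Lemma prime_cone_closed_field (B : comNzRingType) (T : set B) (g : B -> nat) :
  injective g -> prime_cone T ->
  exists (C : closedFieldType) (h : {rmorphism B -> C}),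
    forall b, h b = 0 <-> cone_supp T b.
Proof.
move=> ginj [[TD TMul Tsq] tot T1 Tpr].
pose S : {pred B} := fun x => `[< cone_supp T x >].
have T0 : T 0 by rewrite -[0](expr0n _ 2); apply: Tsq.
have SD x y : cone_supp T x -> cone_supp T y -> cone_supp T (x + y).
  by move=> [? ?] [? ?]; split; rewrite ?opprD; apply: TD.
have SM a x : cone_supp T x -> cone_supp T (a * x).
  move=> [Tx Tnx]; have [Ta|Ta] := tot a.
    by split; rewrite -?mulrN; apply: TMul.
  by split; [rewrite -mulrNN|rewrite -mulNr]; apply: TMul.
have Sid : idealr_closed S.
  split; first by apply/asboolP; split; rewrite ?oppr0.
    by apply/asboolP => -[].
  by move=> a x y /asboolP Sx /asboolP Sy; apply/asboolP; apply: SD => //; apply: SM.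
have Spr : prime_idealr_closed S.
  by move=> x y /asboolP /Tpr [h|h]; apply/orP; [left|right]; apply/asboolP.
pose Sm := isIdealr.Build B S Sid.
pose Sp := isPrimeIdealrClosed.Build B S Spr.
pose J : prime_idealr B := HB.pack S Sm Sp.
have [I [h1 [h1' h1K h1'K]]] := idomain_structure (@Quotient.rquot_IdomainAxiom B J).
pose pJ : {rmorphism B -> {ideal_quot J}} := \pi_({ideal_quot J})%qT.
have [|C [h2 h2inj]] := @idomain_closed_field I (g \o repr \o h1').
  move=> x y /ginj /(can_inj (@reprK _ _)) e.
  exact: (can_inj h1'K).
have pJ0 b : pJ b = 0 <-> cone_supp T b.
  rewrite (rwP eqP) -(rmorph0 pJ) -Quotient.idealrBE subr0.
  by split=> [/asboolP|h]; last apply/asboolP.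
exists C, (h2 \o h1 \o pJ) => b; rewrite -pJ0 /=; split=> [|->]; last by rewrite !rmorph0.
move=> e; apply: (can_inj h1K); apply: h2inj; by rewrite e !rmorph0.
Qed.

(** * Ordered subfields of an algebraically closed field *)

(** Nonnegative constant weights are kept because [F] may lack square roots; they put the
    nonnegative constants in the cone, so that orderings built from it extend that of [F]. *)
Inductive wsos (F : numDomainType) : {poly F} -> Prop :=
| wsos0 : wsos 0
| wsosD (t : F) (g s : {poly F}) of 0 <= t & wsos s : wsos (t *: g ^+ 2 + s).

Section WeightedSquares.
Variable F : realFieldType.
Implicit Types p s g h : {poly F}.

Lemma wsos_add s s' : wsos s -> wsos s' -> wsos (s + s').
Proof.
move=> ws ws'; elim: ws => [|t g s1 t0 _ IH]; first by rewrite add0r.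
by rewrite -addrA; constructor.
Qed.

Lemma wsos_sqZ t g : 0 <= t -> wsos (t *: g ^+ 2).
Proof. by move=> t0; rewrite -[X in wsos X]addr0; constructor; last constructor. Qed.

Lemma wsos_mul s s' : wsos s -> wsos s' -> wsos (s * s').
Proof.
move=> ws ws'; elim: ws => [|t g s1 t0 _ IH]; first by rewrite mul0r; constructor.
rewrite mulrDl; apply: wsos_add IH.
elim: ws' => [|t' g' s2 t'0 _ IH]; first by rewrite mulr0; constructor.
rewrite mulrDr; apply: wsos_add IH.
by rewrite -scalerAl -scalerAr scalerA -exprMn; apply: wsos_sqZ; apply: mulr_ge0.
Qed.

Lemma wsos_horner_ge0 s x : wsos s -> 0 <= s.[x].
Proof.
elim=> [|t g s1 t0 _ IH]; first by rewrite horner0.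
by rewrite hornerD hornerZ horner_exp addr_ge0 // mulr_ge0 // sqr_ge0.
Qed.

(** Each [g] is replaced by [g %% p], of size at most [size p - 1]; its square has size at most
    [2 * size p - 3]. *)
Lemma wsos_modp p s : (1 < size p)%N -> wsos s ->
  exists s' h, [/\ wsos s', (size s' <= (size p).*2 - 3)%N & s = s' + h * p].
Proof.
move=> p1; elim=> [|t g s1 t0 _ [s' [h [ws' sz ->]]]].
  by exists 0, 0; rewrite size_poly0 mul0r addr0; split=> //; constructor.
exists (t *: (g %% p) ^+ 2 + s').
exists (t *: ((g %/ p) * (g + g %% p)) + h); split; first by constructor.
  apply: leq_trans (size_polyD _ _) _; rewrite geq_max sz andbT.
  apply: leq_trans (size_scale_leq _ _) _.
  have aux m k l : (m <= (k + k).-1)%N -> (k < l)%N -> (m <= l.*2 - 3)%N by lia.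
  by apply: aux (size_polyMleq _ _) _; rewrite ltn_modp -size_poly_gt0 ltnW.
by move: (divp_eq g p); move: (g %/ p) (g %% p) => q r ->; rewrite -!mul_polyC; ring.
Qed.

Definition poly_preordering p : set {poly F} :=
  [set f | exists s h, wsos s /\ f = s + h * p].

Lemma poly_preorderingP p : preordering (poly_preordering p).
Proof.
split.
- move=> _ _ [s [h [ws ->]]] [s' [h' [ws' ->]]].
  by exists (s + s'), (h + h'); split; [apply: wsos_add|ring].
- move=> _ _ [s [h [ws ->]]] [s' [h' [ws' ->]]].
  exists (s * s'), (s * h' + h * s' + h * h' * p).
  by split; [apply: wsos_mul|ring].
- move=> x; exists (1 *: x ^+ 2), 0; split; first exact: wsos_sqZ.
  by rewrite scale1r mul0r addr0.
Qed.

(* If [-1 = s + h * p] with [s] reduced modulo [p], then [h] has smaller degree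
   than [p] and also changes sign, and at a root of [h] we get [-1 = s >= 0]. *)
Lemma sign_change_proper p a b :
  (forall h, (size h < size p)%N -> h.[a] * h.[b] < 0 -> exists x, root h x) ->
  p.[a] * p.[b] < 0 -> ~ poly_preordering p (-1).
Proof.
move=> IH pab [s [h0 [ws E]]].
have p1 : (1 < size p)%N.
  rewrite ltnNge; apply/negP => /size1_polyC pC; move: pab.
  by rewrite pC !hornerC -expr2 ltNge sqr_ge0.
have [s' [h' [ws' sz Es]]] := wsos_modp p1 ws.
pose h := h' + h0.
have {}E : h * p = - (1 + s') by rewrite -[1]opprK E Es /h; ring.
have Eh x : h.[x] * p.[x] = - (1 + s'.[x]).
  by rewrite -hornerM E hornerN hornerD hornerC.
have neg x : h.[x] * p.[x] < 0.
  by rewrite Eh oppr_lt0; apply: ltr_wpDr; rewrite ?wsos_horner_ge0.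
have h0' : h != 0.
  by apply/eqP => h0E; have := neg 0; rewrite h0E horner0 mul0r ltxx.
have p0 : p != 0 by rewrite -size_poly_gt0 ltnW.
have hp : (size h < size p)%N.
  have : (size (h * p)%R <= (size p).*2 - 3)%N.
    rewrite E size_polyN; apply: leq_trans (size_polyD _ _) _.
    rewrite geq_max sz andbT size_poly1.
    have aux m : (1 < m)%N -> (1 <= m.*2 - 3)%N by lia.
    exact: aux.
  have aux m k : (1 < m)%N -> ((k + m).-1 <= m.*2 - 3)%N -> (k < m)%N by lia.
  by rewrite size_mul //; apply: aux.
have [|x /rootP hx] := IH h hp.
  have : 0 < (h.[a] * h.[b]) * (p.[a] * p.[b]) by rewrite mulrACA nmulr_rgt0.
  by rewrite nmulr_lgt0.
by have := neg x; rewrite hx mul0r ltxx.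
Qed.

End WeightedSquares.

(** The nonnegative cone of an ordered subfield: the subfield is the union of [T] and [- T], in
    general smaller than [K]. Ordered subfields are thus coded by plain sets, to which Zorn's lemma
    applies. *)
Record is_order (K : fieldType) (T : set K) : Prop := IsOrder {
  order1 : T 1;
  orderD : forall x y, T x -> T y -> T (x + y);
  orderM : forall x y, T x -> T y -> T (x * y);
  orderV : forall x, T x -> T x^-1;
  order_anti : forall x, T x -> T (- x) -> x = 0;
  order_total : forall x y, T x -> T y -> T (x - y) \/ T (y - x) }.

Section OrderedField.
Variables (K : fieldType) (T : set K) (hT : is_order T).

(** Indexed by the proof of [is_order T], so that closure under division can be declared as an
    instance. *)
Definition order_pred of is_order T : {pred K} := fun x => `[< T x \/ T (- x) >].

Lemma order_pred_closed : divring_closed (order_pred hT).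
Proof.
have B x y : x \in order_pred hT -> y \in order_pred hT -> x - y \in order_pred hT.
  move=> /asboolP[Tx|Tx] /asboolP[Ty|Ty]; apply/asboolP; rewrite opprB.
  - exact: order_total.
  - by left; apply: orderD.
  - by right; rewrite addrC; apply: orderD.
  - by have := order_total hT Ty Tx; rewrite !opprK ![- _ + _]addrC.
split=> //; first by apply/asboolP; left; apply: order1.
move=> x y /asboolP[Tx|Tx] /asboolP[Ty|Ty]; apply/asboolP.
- by left; apply: orderM => //; apply: orderV.
- by right; rewrite -mulrN -invrN; apply: orderM => //; apply: orderV.
- by right; rewrite -mulNr; apply: orderM => //; apply: orderV.
- by left; rewrite -mulrNN -invrN; apply: orderM => //; apply: orderV.
Qed.

HB.instance Definition _ := GRing.isDivringClosed.Build K (order_pred hT) order_pred_closed.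

Record ofield := OField { oval : K; ovalP : oval \in order_pred hT }.

HB.instance Definition _ := [isSub for oval].
HB.instance Definition _ := [Choice of ofield by <:].
HB.instance Definition _ := [SubChoice_isSubIntegralDomain of ofield by <:].
HB.instance Definition _ := [SubIntegralDomain_isSubField of ofield by <:].

Definition ole (x y : ofield) : bool := `[< T (oval (y - x)) >].
Definition olt (x y : ofield) : bool := (y != x) && ole x y.
Definition onorm (x : ofield) : ofield := if ole 0 x then x else - x.

Lemma ole0 x : ole 0 x = `[< T (oval x) >].
Proof. by rewrite /ole subr0. Qed.

Lemma olex0 x : ole x 0 = `[< T (- oval x) >].
Proof. by rewrite /ole sub0r. Qed.

Lemma ole_add x y : ole 0 x -> ole 0 y -> ole 0 (x + y).
Proof. rewrite !ole0 => /asboolP hx /asboolP hy; apply/asboolP; exact: orderD. Qed.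

Lemma ole_mul x y : ole 0 x -> ole 0 y -> ole 0 (x * y).
Proof. rewrite !ole0 => /asboolP hx /asboolP hy; apply/asboolP; exact: orderM. Qed.

Lemma ole_anti x : ole 0 x -> ole x 0 -> x = 0.
Proof.
rewrite ole0 olex0 => /asboolP hx /asboolP hnx; apply: val_inj.
by rewrite /= (order_anti hT hx hnx).
Qed.

Lemma osub_ge0 x y : ole 0 (y - x) = ole x y.
Proof. by rewrite /ole subr0. Qed.

Lemma ole_total0 x : ole 0 x || ole x 0.
Proof.
rewrite ole0 olex0; have /asboolP[h|h] := ovalP x; apply/orP.
  by left; apply/asboolP.
by right; apply/asboolP.
Qed.

Lemma onormN x : onorm (- x) = onorm x.
Proof.
rewrite /onorm opprK; have e : ole 0 (- x) = ole x 0 by rewrite /ole subr0 sub0r.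
rewrite e; case: (boolP (ole x 0)) => hx; case: (boolP (ole 0 x)) => hx' //.
  by rewrite (ole_anti hx' hx) oppr0.
by have := ole_total0 x; rewrite (negbTE hx) (negbTE hx').
Qed.

Lemma ge0_onorm x : ole 0 x -> onorm x = x.
Proof. by rewrite /onorm => ->. Qed.

HB.instance Definition _ := Num.IntegralDomain_isLeReal.Build ofield
  ole_add ole_mul ole_anti osub_ge0 ole_total0 onormN ge0_onorm
  (fun x y => erefl : olt x y = (y != x) && ole x y).


End OrderedField.

Section MaximalOrder.
Variables (F : realFieldType) (K : closedFieldType) (v : {rmorphism F -> K}).
Hypothesis vmax : forall T, is_order T -> (forall c, 0 <= c -> T (v c)) ->
  forall x, T x -> exists c, x = v c.

(* Adjoining a root of [p]: a prime cone of [F[X]] above [p] orders [F(alpha)],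
   so [alpha] lies in [F] by maximality. *)
Lemma irreducible_root (p : {poly F}) :
  irreducible_poly p -> ~ poly_preordering p (-1) -> exists x, root p x.
Proof.
move=> irr np1.
have [T' [pT' T0T' _]] : exists T', [/\ prime_cone T', poly_preordering p `<=` T' &
    forall m : {poly F}, [set 1] m -> ~ T' (- m)].
  apply: prime_cone_exists => //.
  - exact: poly_preorderingP.
  - move=> _ ->; exists (1 *: 1 ^+ 2), 0; split; first exact: wsos_sqZ.
    by rewrite expr1n scale1r mul0r addr0.
  - by move=> x y -> ->; rewrite mulr1.
  - by move=> _ ->.
have [[TD TMul Tsq] Ttot Tn1 Tpr] := pT'.
have TC (c : F) : 0 <= c -> T' c%:P.
  move=> c0; apply: T0T'; exists (c *: 1 ^+ 2), 0; split; first exact: wsos_sqZ.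
  by rewrite expr1n mul0r addr0 alg_polyC.
have Tp h : cone_supp T' (h * p).
  split; apply: T0T'; [exists 0, h|exists 0, (- h)]; split; try exact: wsos0.
    by rewrite add0r.
  by rewrite add0r mulNr.
have T0 : T' 0 by have [] := Tp 0; rewrite mul0r.
pose pK : {poly K} := map_poly v p.
have [alpha ra] : exists x, root pK x.
  by apply/closed_rootP; rewrite size_map_poly; case: irr => + _; case: (size p) => [|[]].
pose ev : {rmorphism {poly F} -> K} := horner_eval alpha \o map_poly v.
have evE g : ev g = (map_poly v g).[alpha] by [].
have evp : ev p = 0 by rewrite evE; apply/rootP.
have bez g : ~~ (p %| g) -> exists u w, u * g + w * p = 1.
  move=> ng; have : coprimep g p.
    rewrite coprimep_sym; apply/coprimepP => d dp dg.
    have [//|d1] := boolP (d %= 1).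
    have := irr.2 d _ dp; rewrite -size_poly_eq1 in d1 => /(_ d1) /andP[_ pd].
    by move: ng; rewrite (dvdp_trans pd dg).
  move=> /Bezout_eq1_coprimepP [[u w] /= e]; by exists u, w.
(* Both sides mean that [p] divides [g]: otherwise a Bezout relation makes [ev g] invertible, and
   would put [-1] in [T'] if [g] were in the support. *)
have ev_supp g : ev g = 0 <-> cone_supp T' g.
  split=> [e|[Tg Tng]]; have [/dvdpP[h ->]|/bez[u [w e1]]] := boolP (p %| g).
  - exact: Tp.
  - have := congr1 ev e1; rewrite rmorphD !rmorphM e evp !mulr0 addr0 rmorph1.
    by move=> /eqP; rewrite eq_sym oner_eq0.
  - by rewrite rmorphM evp mulr0.
  - case: Tn1; rewrite -e1 opprD; apply: (TD); last by have [] := Tp w.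
    by have [Tu|Tu] := Ttot u; [rewrite -mulrN|rewrite -mulNr]; apply: (TMul).
pose T2 : set K := [set x | exists2 g, T' g & x = ev g].
have oT2 : is_order T2.
  split.
  - by exists 1; rewrite ?rmorph1 //; rewrite -[1](expr1n _ 2); apply: (Tsq).
  - by move=> _ _ [g Tg ->] [h Th ->]; exists (g + h); rewrite ?rmorphD //; apply: (TD).
  - by move=> _ _ [g Tg ->] [h Th ->]; exists (g * h); rewrite ?rmorphM //; apply: (TMul).
  - move=> _ [g Tg ->]; have [/dvdpP[h ->]|/bez[u [w e1]]] := boolP (p %| g).
      by exists 0; [exact: T0 | rewrite rmorphM evp mulr0 invr0 rmorph0].
    have e2 : ev u * ev g = 1.
      rewrite -rmorphM -[LHS]addr0 -[X in _ + X](mulr0 (ev w)) -evp -rmorphM.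
      by rewrite -rmorphD e1 rmorph1.
    (* [ev u] is the inverse of [ev g]; the factor [g * u] of value 1 turns it into the image of an
       element of the cone. *)
    exists (g * u ^+ 2); first by apply: (TMul).
    have g0 : ev g != 0 by apply/eqP => g0; move/eqP: e2; rewrite g0 mulr0 eq_sym oner_eq0.
    have -> : ev (g * u ^+ 2) = ev g * ev u ^+ 2 by rewrite rmorphM rmorphXn.
    apply: (mulIf g0); rewrite mulVf //; move: e2; move: (ev g) (ev u) => x y e2.
    by rewrite [x * y ^+ 2]mulrC -mulrA -expr2 -exprMn e2 expr1n.
  - move=> _ [g Tg ->] [h Th e]; apply/ev_supp; split=> //.
    have /ev_supp[_ Tgh] : ev (g + h) = 0 by rewrite rmorphD -e subrr.
    have -> : - g = h + - (g + h) by rewrite opprD addrCA subrr addr0.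
    exact: (TD).
  - move=> _ _ [g Tg ->] [h Th ->]; rewrite -!rmorphB.
    have [hh|hh] := Ttot (g - h); [left; by exists (g - h)|right].
    by exists (h - g); rewrite // -opprB.
have TT2 c : 0 <= c -> T2 (v c).
  by move=> c0; exists c%:P; [exact: TC | rewrite evE map_polyC hornerC].
have [c ac] : exists c, alpha = v c.
  have [h|h] := Ttot 'X.
    by apply: (vmax oT2 TT2); exists 'X; rewrite // evE map_polyX hornerX.
  have [|c e] := vmax oT2 TT2 (x := - alpha).
    by exists (- 'X); rewrite // rmorphN evE map_polyX hornerX.
  by exists (- c); rewrite rmorphN -e opprK.
by exists c; move: ra; rewrite /pK /root ac horner_map /= fmorph_eq0.
Qed.

(** Induction on the degree. If [p] factors properly, one factor changes sign. Otherwise [p] is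
    irreducible, and the induction hypothesis supplies what [sign_change_proper] needs for
    [irreducible_root]. *)
Lemma maximal_sign_change (p : {poly F}) (a b : F) :
  a < b -> p.[a] * p.[b] < 0 -> exists2 x, a <= x <= b & root p x.
Proof.
move=> ab; have [n] := ubnP (size p); elim: n p => // n IHn p /ltnSE pn pab.
have [[q [r [pE qp rp]]]|nfac] :=
  pselect (exists q r, [/\ p = q * r, (size q < size p)%N & (size r < size p)%N]).
  have : q.[a] * q.[b] < 0 \/ r.[a] * r.[b] < 0.
    move: pab; rewrite pE !hornerM mulrACA.
    case: (ltP (q.[a] * q.[b]) 0) => [|q0]; first by left.
    case: (ltP (r.[a] * r.[b]) 0) => [|r0]; first by right.
    by rewrite ltNge mulr_ge0.
  case=> /IHn [].
  - exact: leq_trans qp pn.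
  - by move=> x xab rx; exists x; rewrite // pE rootM rx.
  - exact: leq_trans rp pn.
  - by move=> x xab rx; exists x; rewrite // pE rootM rx orbT.
have p1 : (1 < size p)%N.
  rewrite ltnNge; apply/negP => /size1_polyC pC; move: pab.
  by rewrite pC !hornerC -expr2 ltNge sqr_ge0.
have p0 : p != 0 by rewrite -size_poly_gt0 ltnW.
have irr : irreducible_poly p.
  split=> // q q1 qp; rewrite -dvdp_size_eqp //.
  have [r pE] := dvdpP _ _ qp.
  have q0 : q != 0 by apply: contraNneq p0 => q0; rewrite pE q0 mulr0.
  have r0 : r != 0 by apply: contraNneq p0 => r0; rewrite pE r0 mul0r.
  have sE : size p = (size r + size q).-1 by rewrite {1}pE size_mul.
  have q00 : (0 < size q)%N by rewrite size_poly_gt0.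
  have r00 : (0 < size r)%N by rewrite size_poly_gt0.
  rewrite eqn_leq dvdp_leq //= leqNgt; apply/negP => qlt; apply: nfac.
  exists q, r; split=> //; first by rewrite mulrC.
  rewrite sE; move: q1 q00 r00.
  have aux k l : l != 1%N -> (0 < l)%N -> (0 < k)%N -> (k < (k + l).-1)%N by lia.
  exact: aux.
have [x rx] : exists x, root p x.
  apply: irreducible_root => //; apply: (@sign_change_proper _ p a b) => // h hp hab.
  have [|x _ rx] := IHn h _ hab; first exact: leq_trans hp pn.
  by exists x.
(* An irreducible polynomial with a root is linear, and the sign change then places the root between
   [a] and [b]. *)
have : 'X - x%:P %= p by apply: irr.2; rewrite ?size_XsubC // dvdp_XsubCl.
rewrite eqp_sym => /eqpP [[c d] /= /andP[c0 d0] e].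
have {}e : p = (d / c) *: ('X - x%:P).
  by apply: (scalerI c0); rewrite e scalerA mulrC divfK.
exists x => //; move: pab; rewrite e !hornerZ !hornerXsubC mulrACA.
have k0 : 0 < (d / c) * (d / c) by rewrite -expr2 exprn_even_gt0 //= mulf_neq0 // invr_eq0.
rewrite pmulr_rlt0 // => h; apply/andP; split.
  rewrite leNgt; apply/negP => xa; move: h; rewrite ltNge => /negP; apply.
  by apply: mulr_ge0; rewrite subr_ge0 ltW // (lt_trans xa).
rewrite leNgt; apply/negP => xb; move: h; rewrite ltNge => /negP; apply.
by apply: mulr_le0; rewrite subr_le0 ltW // (lt_trans ab).
Qed.

Lemma maximal_ivt : Num.real_closed_axiom F.
Proof.
move=> p a b; rewrite le_eqVlt => /predU1P[<-|ab] /andP[pa pb].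
  by exists a; rewrite ?lexx //; apply/rootP/eqP; rewrite eq_le pa pb.
have [pa0|pa0] := eqVneq p.[a] 0; first by exists a; rewrite ?lexx ?ltW //; apply/rootP.
have [pb0|pb0] := eqVneq p.[b] 0; first by exists b; rewrite ?lexx ?ltW //; apply/rootP.
apply: maximal_sign_change => //.
have lta : p.[a] < 0 by rewrite lt_neqAle pa0.
by rewrite nmulr_rlt0 // lt_neqAle eq_sym pb0.
Qed.
End MaximalOrder.

Section RealClosed.
Variables (K : closedFieldType) (T : set K) (hT : is_order T).
Hypothesis Tmax : forall T', is_order T' -> T `<=` T' -> T' `<=` T.

Lemma ofield_ivt : Num.real_closed_axiom (ofield hT : realFieldType).
Proof.
pose oR : realFieldType := ofield hT.
pose v : {rmorphism oR -> K} := (val : ofield hT -> K).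
have vmax : forall T', is_order T' -> (forall c : oR, 0 <= c -> T' (v c)) ->
    forall x, T' x -> exists c, x = v c; last exact: (maximal_ivt vmax).
move=> T' oT' TT' x T'x.
have Tx : T x.
  apply: Tmax T'x => // y Ty.
  have yin : y \in order_pred hT by apply/asboolP; left.
  apply: (TT' (OField yin)); rewrite -[_ <= _]/(ole 0 _) ole0; exact/asboolP.
have xin : x \in order_pred hT by apply/asboolP; left.
by exists (OField xin).
Qed.

Definition orcf : rcfType :=
  HB.pack (ofield hT) (Num.RealField_isClosed.Build (ofield hT) ofield_ivt).

Lemma orcf_ge0 (x : orcf) : (0 <= x) = `[< T (oval x) >].
Proof. exact: ole0. Qed.
End RealClosed.

(** Each clause of [is_order] concerns at most two elements, so it passes to the union of a nonempty
    chain. *)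
Lemma order_maximal (K : fieldType) (T0 : set K) : is_order T0 ->
  exists T, [/\ is_order T, T0 `<=` T &
    forall T', is_order T' -> T `<=` T' -> T' `<=` T].
Proof.
move=> oT0.
have [//|G [X0 GX0] GP Gtot|T [oT T0T Tmax]] := @zorn_above K [set T | is_order T] T0.
  have pair x y : (\bigcup_(X in G) X) x -> (\bigcup_(X in G) X) y ->
      exists X, [/\ G X, X x & X y].
    move=> [X GX Xx] [Y GY Yy]; have [h|h] := Gtot _ _ GX GY.
      by exists Y; split=> //; apply: h.
    by exists X; split=> //; apply: h.
  split.
  - by exists X0 => //; apply: order1; apply: GP.
  - move=> x y Ux Uy; have [X [GX Xx Xy]] := pair _ _ Ux Uy.
    by exists X => //; apply: (orderD (GP _ GX)).
  - move=> x y Ux Uy; have [X [GX Xx Xy]] := pair _ _ Ux Uy.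
    by exists X => //; apply: (orderM (GP _ GX)).
  - by move=> x [X GX Xx]; exists X => //; apply: (orderV (GP _ GX)).
  - by move=> x Ux Uy; have [X [GX Xx Xy]] := pair _ _ Ux Uy; apply: (order_anti (GP _ GX)).
  - move=> x y Ux Uy; have [X [GX Xx Xy]] := pair _ _ Ux Uy.
    by have [h|h] := order_total (GP _ GX) Xx Xy; [left|right]; exists X.
by exists T; split=> // T' oT' TT'; apply: Tmax.
Qed.

(** The ordering induced by the cone on the fraction field of the quotient by the support. A
    fraction with arbitrary numerator and denominator is one of these up to sign. *)
Lemma prime_cone_order (B : comNzRingType) (T : set B) (K : fieldType)
    (h : {rmorphism B -> K}) :
  prime_cone T -> (forall b, h b = 0 <-> cone_supp T b) ->
  is_order [set x | exists a b, [/\ T a, T b, h b != 0 & x = h a / h b]].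
Proof.
move=> [[TD TMul Tsq] Ttot Tn1 Tpr] hs.
have T1 : T 1 by rewrite -[1](expr1n _ 2); apply: (Tsq).
have h1 : h 1 != 0 by rewrite rmorph1 oner_eq0.
split.
- by exists 1, 1; split=> //; rewrite divff.
- move=> _ _ [a [b [Ta Tb b0 ->]]] [c [d [Tc Td d0 ->]]].
  exists (a * d + c * b), (b * d); split; first by apply: (TD); apply: (TMul).
  + exact: (TMul).
  + by rewrite rmorphM mulf_neq0.
  + by rewrite rmorphD !rmorphM addf_div.
- move=> _ _ [a [b [Ta Tb b0 ->]]] [c [d [Tc Td d0 ->]]].
  exists (a * c), (b * d); split; [exact: (TMul)|exact: (TMul)| |].
  + by rewrite rmorphM mulf_neq0.
  + by rewrite !rmorphM mulf_div.
- move=> _ [a [b [Ta Tb b0 ->]]]; have [a0|a0] := eqVneq (h a) 0.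
    by exists a, 1; split=> //; rewrite a0 !mul0r invr0.
  by exists b, a; split=> //; rewrite invf_div.
- move=> _ [a [b [Ta Tb b0 ->]]] [c [d [Tc Td d0 e]]].
  have /hs [_ Ts] : h (a * d + c * b) = 0.
    have : h a / h b + h c / h d = 0 by rewrite -e subrr.
    rewrite addf_div // rmorphD !rmorphM => /eqP; rewrite mulf_eq0 invr_eq0.
    by rewrite (negbTE (mulf_neq0 b0 d0)) orbF => /eqP.
  have : cone_supp T (a * d).
    split; first exact: (TMul).
    have -> : - (a * d) = c * b + - (a * d + c * b) by ring.
    by apply: (TD) => //; apply: (TMul).
  by case/Tpr => /hs e0; [rewrite e0 mul0r | rewrite e0 eqxx in d0].
- move=> _ _ [a [b [Ta Tb b0 ->]]] [c [d [Tc Td d0 ->]]].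
  have E : h a / h b - h c / h d = h (a * d - c * b) / h (b * d).
    by rewrite -mulNr addf_div // rmorphB !rmorphM mulNr.
  have bd0 : h (b * d) != 0 by rewrite rmorphM mulf_neq0.
  have Tbd : T (b * d) by apply: (TMul).
  have [t|t] := Ttot (a * d - c * b); [left|right].
    by exists (a * d - c * b), (b * d); split.
  by exists (- (a * d - c * b)), (b * d); split=> //; rewrite -opprB E rmorphN mulNr.
Qed.

(** The induced ordering is enlarged to a maximal one, whose subfield is real closed; as the cone is
    total, [h] takes its values in that subfield. *)
Lemma prime_cone_rcf (B : comNzRingType) (T : set B) (g : B -> nat) :
  injective g -> prime_cone T ->
  exists (F : rcfType) (f : {rmorphism B -> F}),
    (forall b, T b -> 0 <= f b) /\ (forall b, f b = 0 -> cone_supp T b).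
Proof.
move=> ginj pT; have [K [h hs]] := prime_cone_closed_field ginj pT.
have [T2 [oT2 T1T2 T2max]] := order_maximal (prime_cone_order pT hs).
have [_ Ttot _ _] := pT.
have hT b : T b -> T2 (h b).
  move=> Tb; apply: T1T2; exists b, 1; rewrite rmorph1 divr1 oner_eq0; split=> //.
  by have [[_ _ Tsq] _ _ _] := pT; rewrite -[1](expr1n _ 2); apply: (Tsq).
have hin b : h b \in order_pred oT2.
  by apply/asboolP; have [/hT|/hT] := Ttot b; rewrite ?rmorphN; [left|right].
pose f0 (b : B) : orcf oT2 T2max := OField (hin b).
have f0B : zmod_morphism f0 by move=> x y; apply: val_inj; rewrite /= rmorphB.
have f0M : monoid_morphism f0.
  by split=> [|x y]; apply: val_inj; rewrite /= ?rmorph1 ?rmorphM.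
pose f : {rmorphism B -> orcf oT2 T2max} :=
  HB.pack f0 (GRing.isZmodMorphism.Build _ _ f0 f0B) (GRing.isMonoidMorphism.Build _ _ f0 f0M).
exists (orcf oT2 T2max), f; split=> [b Tb|b].
  by rewrite orcf_ge0; apply/asboolP; apply: hT.
by move=> /(congr1 (@oval _ _ _)) /= e; apply/hs.
Qed.

(** * The real Nullstellensatz for a principal ideal *)

Section Nullstellensatz.
Variables (R : rcfType) (n : nat).
Local Notation A := (mpoly.mpoly n R).
Local Notation "c %:MP" := (mpoly.mpolyC n c) (at level 2, format "c %:MP").

Definition sos_preordering (Q : A) : set A :=
  [set f | exists (s : seq A) H, f = \sum_(g <- s) g ^+ 2 + H * Q].

Lemma sos_preorderingP (Q : A) : preordering (sos_preordering Q).
Proof.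
split.
- move=> _ _ [s [H ->]] [s' [H' ->]]; exists (s ++ s'), (H + H').
  by rewrite big_cat mulrDl addrACA.
- move=> _ _ [s [H ->]] [s' [H' ->]].
  set S := \sum_(g <- s) _; set S' := \sum_(g <- s') _.
  exists [seq x * y | x <- s, y <- s'], (S * H' + H * S' + H * H' * Q).
  rewrite big_allpairs_dep /=.
  rewrite (_ : \sum_(x <- s) _ = S * S'); first by ring.
  rewrite big_distrl; apply: eq_bigr => x _ /=; rewrite big_distrr.
  by apply: eq_bigr => y _; rewrite /= exprMn.
- by move=> x; exists [:: x], 0; rewrite big_seq1 mul0r addr0.
Qed.

Lemma mpoly_image (B : comNzRingType) (h : {rmorphism B -> A}) (P : A) :
  (forall m, m \in mpoly.msupp P -> exists b, h b = (mpoly.mcoeff m P)%:MP) ->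
  (forall i : 'I_n, exists b, h b = mpoly.mpolyX R (mpoly.mnm1 i)) ->
  exists b, h b = P.
Proof.
move=> hC hX.
have hX' i k : exists b, h b = mpoly.mpolyX R (mpoly.mnm1 i) ^+ k.
  by have [b hb] := hX i; exists (b ^+ k); rewrite rmorphXn hb.
have hM m : exists b, h b = mpoly.mpolyX R m.
  rewrite mpoly.mpolyXE_id; elim/big_ind: _ => [|x y [b <-] [c <-]|i _].
  - by exists 1; rewrite rmorph1.
  - by exists (b * c); rewrite rmorphM.
  - exact: hX'.
rewrite [P]mpoly.mpolyE big_seq; elim/big_ind: _ => [|x y [b <-] [c <-]|m mP].
- by exists 0; rewrite rmorph0.
- by exists (b + c); rewrite rmorphD.
- have [b hb] := hC m mP; have [c hc] := hM m.
  by exists (b * c); rewrite rmorphM hb hc mpoly.mul_mpolyC.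
Qed.

(** [phi] is a point over a real closed field at which [q] vanishes and [p] does not; transfer of
    the signs of [p] and [q] gives a point over [R]. *)
Lemma prime_cone_point (T : set A) (P Q : A) :
  prime_cone T -> cone_supp T Q -> ~ cone_supp T P ->
  exists x : 'I_n -> R, mpoly.meval x Q = 0 /\ mpoly.meval x P <> 0.
Proof.
move=> pT TQ nTP; have [[TD TM Tsq] Ttot Tn1 Tpr] := pT.
(* The coefficients are made into variables so that the rings involved are countable. *)
pose cs := [seq mpoly.mcoeff m P | m <- mpoly.msupp P] ++
           [seq mpoly.mcoeff m Q | m <- mpoly.msupp Q].
pose k := size cs.
pose D := itp int k.
pose c : {rmorphism D -> R} := evl (intr : {rmorphism int -> R}) k (fun i => cs`_i).
pose cA : {rmorphism D -> A} := (@mpoly.mpolyC n R : {rmorphism R -> A}) \o c.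
pose X i : A := if insub i is Some j then mpoly.mpolyX R (mpoly.mnm1 (j : 'I_n)) else 0.
pose ev : {rmorphism itp D n -> A} := evl cA n X.
have evC d : exists b, (forall (E : comNzRingType) (f : {rmorphism D -> E}) a,
    evl f n a b = f d) /\ ev b = (c d)%:MP.
  by have [b hb] := evl_const n d; exists b; split=> //; rewrite /ev hb.
have coef r : r \in cs -> exists b, ev b = r%:MP.
  move=> rcs; have ik : (index r cs < k)%N by rewrite index_mem.
  have [d hd] := evl_var int ik; have [b [_ hb]] := evC d.
  by exists b; rewrite hb /c hd nth_index.
have var (i : 'I_n) : exists b, ev b = mpoly.mpolyX R (mpoly.mnm1 i).
  have [b hb] := evl_var D (ltn_ord i); exists b.
  by rewrite /ev hb /X valK.
have [p evp] : exists p, ev p = P.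
  by apply: mpoly_image var => m mP; apply: coef; rewrite mem_cat; apply/orP; left; apply: map_f.
have [q evq] : exists q, ev q = Q.
  by apply: mpoly_image var => m mP; apply: coef; rewrite mem_cat; apply/orP; right; apply: map_f.
pose TB : set (itp D n) := [set b | T (ev b)].
have pTB : prime_cone TB.
  split; first split.
  - by move=> x y; rewrite /TB /= rmorphD; apply: TD.
  - by move=> x y; rewrite /TB /= rmorphM; apply: TM.
  - by move=> x; rewrite /TB /= rmorphXn; apply: Tsq.
  - by move=> x; rewrite /TB /= rmorphN; apply: Ttot.
  - by rewrite /TB /= rmorphN rmorph1.
  - by move=> x y; rewrite /cone_supp /TB /= !rmorphN rmorphM; apply: Tpr.
have [g ginj] : exists g : itp D n -> nat, injective g.
  apply: itp_countable; apply: itp_countable.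
  by exists pickle; apply: (pcan_inj (@pickleK _)).
have [F [phi [phi_ge0 phi_supp]]] := prime_cone_rcf ginj pTB.
have [f1 [a1 phiE]] := itp_morphism phi.
have Tc (r : R) : 0 <= r -> T r%:MP.
  by move=> r0; rewrite -(sqr_sqrtr r0) rmorphXn; apply: Tsq.
(* [R] has a unique ordering and its nonzero elements are units, so the ordering
   of [F] restricts to that of [R] on [D]. *)
have sgD d : sgz (f1 d) = sgz (c d).
  have [b [bd evb]] := evC d.
  have fE : f1 d = phi b by rewrite phiE bd.
  have unit_supp : c d != 0 -> phi b != 0.
    move=> cd0; apply/eqP => /phi_supp; rewrite /cone_supp /TB /= rmorphN evb => -[Td Tnd].
    have e : (c d)%:MP * (c d)^-1%:MP = 1 by rewrite -rmorphM mulfV // rmorph1.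
    case: (Ttot (c d)^-1%:MP) => Tr; apply: Tn1; rewrite -e.
      by rewrite -mulNr; apply: TM.
    by rewrite -mulrN; apply: TM.
  rewrite fE; case: (sgzP (c d)) => hd.
  - have b0 : 0 <= phi b by apply: phi_ge0; rewrite /TB /= evb hd; apply: Tc.
    have nb0 : 0 <= phi (- b).
      by apply: phi_ge0; rewrite /TB /= rmorphN evb hd -rmorphN oppr0; apply: Tc.
    apply/eqP; rewrite sgz_eq0 eq_le b0 andbT -oppr_ge0.
    by rewrite rmorphN in nb0.
  - have b0 : 0 <= phi b by apply: phi_ge0; rewrite /TB /= evb; apply: Tc; apply: ltW.
    by apply: gtr0_sgz; rewrite lt_def b0 unit_supp // gt_eqF.
  - have nb0 : 0 <= phi (- b).
      by apply: phi_ge0; rewrite /TB /= rmorphN evb -rmorphN; apply: Tc; rewrite oppr_ge0 ltW.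
    rewrite rmorphN oppr_ge0 in nb0.
    by apply: ltr0_sgz; rewrite lt_def eq_sym unit_supp ?lt_eqF.
have [T' HT'] := evl_sign_decided [:: p; q].
(* [sgD] covers all of [D], so the two morphisms agree on whatever list the elimination returns. *)
have [|a2 Ha2] := HT' F R f1 c _ a1; first by move=> t _.
pose x (j : 'I_n) := a2 j.
have meE b : mpoly.meval x (ev b) = evl c n a2 b.
  apply: evl_comp => [d|i ilt]; first by rewrite /= mpoly.mevalC.
  by rewrite /X (insubT (fun i => (i < n)%N) ilt) /= mpoly.mevalXU.
have sgE b : b \in [:: p; q] -> sgz (phi b) = sgz (mpoly.meval x (ev b)).
  by rewrite phiE meE; apply: Ha2.
exists x; split.
  apply/eqP; rewrite -sgz_eq0 -evq -sgE ?inE ?eqxx ?orbT // sgz_eq0.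
  have [TQ1 TQ2] := TQ.
  have q0 : 0 <= phi q by apply: phi_ge0; rewrite /TB /= evq.
  have : 0 <= phi (- q) by apply: phi_ge0; rewrite /TB /= rmorphN evq.
  by rewrite rmorphN oppr_ge0 => q0'; rewrite eq_le q0 q0'.
move=> P0; have := sgE p (mem_head _ _); rewrite evp P0 sgz0 => /eqP; rewrite sgz_eq0.
by move=> /eqP /phi_supp; rewrite /cone_supp /TB /= rmorphN evp.
Qed.

Theorem real_nullstellensatz (P Q : A) :
  (forall x : 'I_n -> R, mpoly.meval x Q = 0 -> mpoly.meval x P = 0) ->
  exists k (s : seq A) H, P ^+ k.*2 + \sum_(f <- s) f ^+ 2 = H * Q.
Proof.
move=> QP; apply: contrapT => nH.
(* The even powers of [P] are squares, so they lie in the preordering; keeping [- P ^+ 2] out of [T]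
   keeps [P] out of the support. *)
have [||||T [pT T0T TM]] := @prime_cone_exists A (sos_preordering Q)
    [set P ^+ k.*2 | k in setT] (sos_preorderingP Q).
- by exists 0%N; rewrite // expr0.
- by move=> _ [k _ <-]; exists [:: P ^+ k], 0; rewrite big_seq1 mul0r addr0 -exprM muln2.
- by move=> _ _ [k _ <-] [l _ <-]; exists (k + l)%N; rewrite // doubleD exprD.
- move=> _ [k _ <-] [s [H e]]; apply: nH; exists k, s, (- H).
  by rewrite mulNr -[LHS]opprK opprD e; ring.
have TQ : cone_supp T Q.
  split; apply: T0T; [exists [::], 1|exists [::], (-1)]; rewrite big_nil add0r.
    by rewrite mul1r.
  by rewrite mulN1r.
have nTP : ~ cone_supp T P.
  move=> [TP TnP]; apply: (TM (P ^+ 2)); first by exists 1%N.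
  by have [[_ TMul _] _ _ _] := pT; rewrite expr2 -mulNr; apply: TMul.
by have [x [/QP Px nPx]] := prime_cone_point pT TQ nTP.
Qed.
End Nullstellensatz.

(** * Positive definite functionals and type A *)

Section PositiveDefinite.
Variables (R : realType) (n : nat) (L : {scalar mpoly.mpoly n R}).
Hypothesis Lpd : positive_definite L.

(* The quadratic polynomial [t |-> L ((g + t f) ^ 2)] is nonnegative with leading
   coefficient [L (f ^ 2) = 0], so its linear coefficient [2 L (f g)] vanishes. *)
Lemma positive_definite_kernel f : L (f ^+ 2) = 0 -> forall g, L (f * g) = 0.
Proof.
move=> Lf0 g; apply/eqP; apply: contraT => b0.
(* With this [t] the quadratic polynomial takes the value [-1]. *)
pose t := - (L (g ^+ 2) + 1) / (2 * L (f * g)).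
have := Lpd (g + t *: f).
rewrite sqrrD exprZn -scalerAr [g * f]mulrC mulr2n !linearD !linearZ /= Lf0 mulr0 addr0.
have -> : t * L (f * g) + t * L (f * g) = - (L (g ^+ 2) + 1) by rewrite /t; field.
by rewrite opprD addrA subrr add0r oppr_ge0 ler10.
Qed.

(** The kernel lemma for [f ^+ k] gives [L (f ^+ k * g) = 0] for all [g]. Taking [g] to be 1 or [f],
    by the parity of [k], yields an even exponent again, about half the old one. For [k = 0] the
    hypothesis is [L 1 = 0], which forces [L = 0]. *)
Lemma positive_definite_expr f k :
  L (f ^+ k.*2) = 0 -> forall g, L (f * g) = 0.
Proof.
elim/ltn_ind: k => -[|[|k]] IH Lf g.
- by rewrite -[f * g]mul1r; apply: positive_definite_kernel; rewrite expr1n -[1](expr0 f).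
- exact: positive_definite_kernel.
- apply: (IH (uphalf k.+2)); first by lia.
  have -> : f ^+ (uphalf k.+2).*2 = f ^+ k.+2 * f ^+ odd k.
    by rewrite -exprD; congr (_ ^+ _); lia.
  by apply: positive_definite_kernel; rewrite -exprM muln2.
Qed.

Lemma positive_definite_zero_set (P Q : mpoly.mpoly n R) :
  zero_set Q `<=` zero_set P ->
  (forall F, principal_ideal Q F -> L F = 0) ->
  forall F, principal_ideal P F -> L F = 0.
Proof.
move=> QP LQ _ [S ->]; rewrite mulrC.
have [x Qx|k [s [H e]]] := @real_nullstellensatz R n P Q.
  have ex : (\row_j x j : 'rV[R]_n) ord0 = x by apply: funext => j; rewrite mxE.
  by have := QP (\row_j x j); rewrite /zero_set /mpoly_eval /= ex; apply.
apply: (@positive_definite_expr _ k).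
(* [L] is nonnegative on both summands and kills their sum, so it kills each. *)
have : L (P ^+ k.*2 + \sum_(f <- s) f ^+ 2) = 0 by apply: LQ; exists H.
rewrite linearD linear_sum /= => /eqP; rewrite paddr_eq0.
- by case/andP => /eqP.
- by rewrite -muln2 exprM; apply: Lpd.
- by apply: sumr_ge0 => f _; apply: Lpd.
Qed.
End PositiveDefinite.

(** A positive definite functional vanishing on the ideal of [Q] also vanishes on that of [P], so
    type A of [P] applies to it. *)
Lemma type_A_zero_set (R : realType) (n : nat) (P Q : mpoly.mpoly n R) :
  zero_set Q `<=` zero_set P -> type_A P -> type_A Q.
Proof.
move=> QP AP L Lpd LQ; apply: AP => //.
exact: (positive_definite_zero_set Lpd QP LQ).
Qed.

Theorem theorem3p1 (R : realType) (n : nat) (P Q : mpoly.mpoly n R) :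
  (1 <= n)%N -> zero_set P = zero_set Q -> (type_A P <-> type_A Q).
Proof.
by move=> _ PQ; split; apply: type_A_zero_set; rewrite PQ.
Qed.
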